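(* Let $G$ be a loopless graph. Then the neighbourhood-set system $(V(G),\mathcal{N}(G))$ is a maximum system if and only if $G$ is a nonempty set of isolated vertices (i.e. has no edges).
   Context: Graphs are finite, undirected, with nonempty vertex set and no multiple edges. $N_G(v)$ is the set of vertices adjacent to $v$, and $\mathcal{N}(G)=\{N_G(v):v\in V(G)\}$ (without multiplicities). For a set system $(X,\mathcal{F})$ ($X$ a finite set, $\mathcal{F}$ a nonempty family of distinct subsets of $X$) and $Y\subseteq X$, let $\mathcal{F}\cap Y=\{A\cap Y:A\in\mathcal{F}\}$; $Y$ is shattered if $\mathcal{F}\cap Y$ is the full power set of $Y$, and the VC-dimension is the largest size of a shattered set. The system, with VC-dimension $d$, is maximum if $|\mathcal{F}\cap Y|=\sum_{i=0}^d\binom{|Y|}{i}$ for every $Y\subseteq X$. *)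

(* Defs.v *)
From mathcomp Require Import all_boot.

Set Implicit Arguments.
Unset Strict Implicit.
Unset Printing Implicit Defensive.

(* A set system (X, F) is a family F : {set {set T}}, with X the whole finite
   type T. *)
Section SetSystems.
Variable T : finType.
Implicit Types (F : {set {set T}}) (Y : {set T}).

Definition trace F Y : {set {set T}} := [set A :&: Y | A in F].

Definition shattered F Y : bool := trace F Y == powerset Y.

(* When F is nonempty, set0 is shattered, so this is a maximum over a nonempty
   set; for F = set0 it is 0 by convention. *)
Definition VCdim F : nat := \max_(Y : {set T} | shattered F Y) #|Y|.

Definition maximum_system F : Prop :=
  F != set0 /\
  forall Y, #|trace F Y| = \sum_(0 <= i < (VCdim F).+1) 'C(#|Y|, i).

End SetSystems.

(* A finite undirected graph without multiple edges, loops allowed, with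
   nonempty vertex set. *)
Record graph := Graph {
  vertex : finType;
  adj : rel vertex;
  adj_sym : symmetric adj;
  vertex_nonempty : 0 < #|vertex|
}.

Definition loopless (G : graph) : Prop := irreflexive (@adj G).

Definition nbhd (G : graph) (v : vertex G) : {set vertex G} :=
  [set u | adj v u].

Definition nbhd_system (G : graph) : {set {set vertex G}} :=
  [set nbhd v | v : vertex G].

Definition isolated (G : graph) (v : vertex G) : Prop :=
  forall u : vertex G, ~~ adj v u.

(* Main.v *)
Require Import Defs.
From mathcomp Require Import all_boot.

(** If the VC-dimension [d] is positive, a maximum system on [n] points has at
    least [1 + n] members, whereas a graph has at most [n] distinct
    neighbourhoods. Hence [d = 0] and all neighbourhoods coincide; an edge [vu]
    would then put [u] in its own neighbourhood, which is impossible without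
    loops. *)

Lemma trace_setT (T : finType) (F : {set {set T}}) : trace F setT = F.
Proof.
rewrite /trace (eq_imset (g := id)) ?imset_id // => A.
exact: setIT.
Qed.

Lemma trace_set1 (T : finType) (A Y : {set T}) :
  trace [set A] Y = [set A :&: Y].
Proof. exact: imset_set1. Qed.

(** A trace of a one-member family has one member, while [powerset Y] has [2 ^ #|Y|], so only the
    empty set is shattered. *)
Lemma VCdim_set1 (T : finType) (A : {set T}) : VCdim [set A] = 0.
Proof.
apply/eqP; rewrite -leqn0; apply/bigmax_leqP => Y /eqP.
rewrite trace_set1 => /(congr1 (fun F : {set {set T}} => #|F|)) /eqP.
by rewrite cards1 card_powerset -{1}(expn0 2) eqn_exp2l // => /eqP <-.
Qed.

Lemma maximum_system_set1 (T : finType) (A : {set T}) :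
  maximum_system [set A].
Proof.
split; first by apply/set0Pn; exists A; rewrite set11.
by move=> Y; rewrite VCdim_set1 trace_set1 cards1 big_nat1 bin0.
Qed.

Lemma maximum_system_card (T : finType) (F : {set {set T}}) :
  maximum_system F -> #|F| <= #|T| -> #|F| = 1.
Proof.
case=> _ /(_ setT); rewrite trace_setT cardsT.
case: (VCdim F) => [-> _|d ->]; first by rewrite big_nat1 bin0.
(* On the whole ground set, the terms [i = 0] and [i = 1] alone give [1 + #|T|], exceeding the
   assumed bound. *)
by rewrite big_nat_recl // big_nat_recl // bin0 bin1 addnA add1n ltnNge leq_addr.
Qed.

Theorem corollary5p9 (G : graph) (hG : loopless G) :
  maximum_system (nbhd_system G) <-> (forall v : vertex G, isolated v).
Proof.
split=> [maxG v u | isoG].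
  have /eqP/cards1P[A nbhdsE] := maximum_system_card _ _ maxG (leq_imset_card _ _).
  have nbhdE (w : vertex G) : nbhd w = A.
    by apply/set1P; rewrite -nbhdsE; apply: imset_f.
  apply/negP => vu; have: u \in nbhd u by rewrite nbhdE -(nbhdE v) inE.
  by rewrite inE hG.
suff -> : nbhd_system G = [set set0] by apply: maximum_system_set1.
have nbhd0 (v : vertex G) : nbhd v = set0.
  by apply/setP => u; rewrite !inE; apply/negbTE/isoG.
(* Some vertex must exist for [set0] to occur as a neighbourhood; otherwise the family would be
   empty. *)
have /card_gt0P[v0 _] := vertex_nonempty G.
apply/setP => A; rewrite inE; apply/imsetP/eqP => [[v _ ->] // | ->].
by exists v0; rewrite ?nbhd0.
Qed.
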